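(* The DoF-transfer operation preserves exactness: let $n\in\{2,3\}$, let $\mathcal{T}_h$ be a mesh consisting of $n$-cubes, and let $(P^k,\square_n,D^k)$, $0\le k\le n$, be a sequence of finite elements of differential $k$-forms to which the DoF-transfer operation $\mathscr{T}$ (defined in the context) applies, with associated global spaces $V^k$ on $\mathcal{T}_h$. If the sequence $$0\to\mathbb{R}\to V^0\xrightarrow{d}V^1\xrightarrow{d}\cdots\xrightarrow{d}V^n\to0$$ is exact, then the sequence $$0\to\mathbb{R}\to\mathscr{T}V^0\xrightarrow{d}\mathscr{T}V^1\xrightarrow{d}\cdots\xrightarrow{d}\mathscr{T}V^n\to0$$ of global spaces associated with $\mathscr{T}(P^k,\square_n,D^k)$, $0\le k\le n$, is also exact.
   Context: Cubes are axis-parallel and meshes are conforming. $P^k$ is a space of polynomial differential $k$-forms on the cube and $D^k$ a unisolvent set of degrees of freedom (DoFs), all of the type $u\mapsto\int_f(\mathrm{tr}_fu)\wedge q$, $q\in\mathcal{I}_f$, for faces $f$ of $\square_n$ with $k\le\dim f\le n$, where $\mathcal{I}_f$ is a space of polynomial $(\dim f-k)$-forms on $f$ (vertex DoFs occur only for $k=0$ and are point evaluations). The global space $V^k$ consists of piecewise $P^k$ functions on $\mathcal{T}_h$ for which the DoFs on shared vertices, edges and faces are single-valued; the elements are conforming in the sense that $V^k$ consists exactly of piecewise $P^k$ forms whose traces are single-valued on inter-element faces. $d$ is the exterior derivative. In vector proxies, for $n=3$: $d=\operatorname{grad},\operatorname{curl},\operatorname{div}$ and the edge trace of a 1-form $\bm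 v$ is $\bm v\cdot\bm\tau_e$; for $n=2$, in rotated convention: $d=\operatorname{curl},\operatorname{div}$ with $\operatorname{curl}u=(-\partial_2u,\partial_1u)^T$ and the edge trace of a 1-form is $\bm v\cdot\bm\nu_e$. As for all sequences in the paper there is $r\ge3$ such that on each edge $e$ the traces of $P^0$ form $\mathcal{P}_r(e)$, with $\mathcal{I}_e=\mathcal{P}_{r-2}(e)$, and the traces of $P^1$ form $\mathcal{P}_{r-1}(e)$, with $\mathcal{I}_e=\mathcal{P}_{r-1}(e)$ ($\mathcal{P}_m(e)$: polynomials of degree at most $m$, zero if $m<0$). The DoF-transfer operation $\mathscr{T}$ keeps every $P^k$ and changes two DoFs on each edge, for $k=0,1$ only. For $k=0$ the edge moments against $\mathcal{P}_{r-2}(e)$ are replaced by moments against $\mathcal{P}_{r-4}(e)$ and the derivatives along $e$ at the two endpoints. For $k=1$ the edge moments against $\mathcal{P}_{r-1}(e)$ are replaced by moments against $\mathcal{P}_{r-3}(e)$ and the values of the edge-trace component of $\bm v$ at the two endpoints. Globally, the new DoFs at a mesh vertex $x$, i.e. all first partial derivatives $\partial_iu(x)$ for $k=0$ and the full vector $\bm v(x)$ for $k=1$, are required to be single-valued over all elements sharing $x$. Thus $\mathscr{T}V^0=\{u\in V^0: \text{first derivatives of }u\text{ single-valued at all vertices}\}$, $\mathscr{T}V^1=\{\bm v\in V^1:\bm v\text{ single-valued at all vertices}\}$ and $\mathscr{T}V^k=V^k$ for $k\ge2$. *)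

(* Defs.v *)
(* MathComp-Analysis and multinomials.  The notations of mpoly clash with those
   of MathComp-Analysis, so only its constants are imported. *)
From mathcomp Require Import all_boot all_order all_algebra.
From mathcomp Require mpoly.
From mathcomp Require Import all_classical all_reals all_analysis.
Export -(notations) mpoly.

Set Implicit Arguments.
Unset Strict Implicit.
Unset Printing Implicit Defensive.

Import Order.TTheory GRing.Theory Num.Theory.

Local Open Scope classical_set_scope.
Local Open Scope ring_scope.

Section Forms.
Variables (R : realType) (n : nat).

Definition pt := {ffun 'I_n -> R}.

(* A polynomial differential form on R^n, as the family of its coefficients:
   w stands for the sum over S of w S dx_S, where
   dx_S = dx_{i_1} /\ ... /\ dx_{i_k} for S = {i_1 < ... < i_k}. *)
Definition polyform := {ffun {set 'I_n} -> mpoly n R}.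

Definition kforms (k : nat) : set polyform :=
  [set w | forall S : {set 'I_n}, #|S| != k -> w S = 0].

Definition const_form (c : R) : polyform :=
  [ffun S : {set 'I_n} => if S == finset.set0 then mpolyC n c else 0].

Definition dform (w : polyform) : polyform :=
  [ffun S : {set 'I_n} =>
    \sum_(i in S) (-1) ^+ #|[set j in S | (j < i)%N]%SET|
                    *: mderiv i (w (S :\ i)%SET)].

(* The sign is that of the permutation sorting A followed by S \ A. *)
Definition fwedge (v w : polyform) : polyform :=
  [ffun S : {set 'I_n} =>
    \sum_(A : {set 'I_n} | A \subset S)
       (-1) ^+ #|[set p in finset.setX A (S :\: A)%SET | (p.2 < p.1)%N]%SET|
         *: (v A * w (S :\: A)%SET)].

(* The product of the intervals [lo i, hi i].  Some of them may be reduced to a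
   point, so that cubes and all their faces, down to vertices, are boxes. *)
Record box := Box { lo : pt; hi : pt }.

Definition in_box (f : box) (x : pt) : Prop :=
  forall i, lo f i <= x i <= hi f i.

Definition dirs (f : box) : {set 'I_n} := [set i | lo f i < hi f i]%SET.

Definition fdim (f : box) : nat := #|dirs f|.

(* Faces of all dimensions from 0 to n, K itself included. *)
Definition face (f K : box) : Prop :=
  forall i, [\/ lo f i = lo K i /\ hi f i = hi K i,
                lo f i = lo K i /\ hi f i = lo K i
              | lo f i = hi K i /\ hi f i = hi K i].

(* Pullback to f: the coordinates that are constant on f are replaced by their
   values, and the corresponding dx_i are killed. *)
Definition ftrace (f : box) (w : polyform) : polyform :=
  [ffun S : {set 'I_n} =>
    if S \subset dirs f then
      comp_mpoly
        [tuple if i \in dirs f then mpolyX R (mnm1 i) else mpolyC n (lo f i)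
          | i < n]
        (w S)
    else 0].

(* A form on f is identified with the form on R^n that involves only the
   coordinates and differentials tangent to f. *)
Definition forms_on (f : box) (j : nat) : set polyform :=
  [set w | kforms j w /\ ftrace f w = w].

(* Forms of degree j on f with coefficients in P_m(f), which is zero if m < 0.
   Recall that msize is one plus the degree, and that msize 0 = 0. *)
Definition poly_forms (m : int) (f : box) (j : nat) : set polyform :=
  [set w | forms_on f j w /\
           forall S : {set 'I_n}, (msize (w S))%:Z <= m + 1].

Fixpoint iter_integral (s : seq 'I_n) (f : box) (g : pt -> R) (x : pt)
    : R :=
  match s with
  | [::] => g x
  | i :: s' =>
      \int[lebesgue_measure]_(t in `[lo f i, hi f i])
        iter_integral s' f g [ffun j => if j == i then t else x j]
  end.

(* The integral over f, oriented by increasing coordinates, of a form of degree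
   fdim f; for a vertex it is the value at that vertex. *)
Definition integral_form (f : box) (w : polyform) : R :=
  iter_integral (enum (dirs f)) f (fun x => meval x (w (dirs f))) (lo f).

Definition moment (f : box) (q u : polyform) : R :=
  integral_form f (fwedge (ftrace f u) q).

(* V is a finite-dimensional linear space, given as the span of a finite list. *)
Definition fin_dim (V : set polyform) : Prop :=
  exists s : seq polyform,
    V = [set w | exists c : nat -> R, w = \sum_(i < size s) c i *: s`_i].

(* D k f is the set of the degrees of freedom on k-forms attached to f. *)
Definition dofs := nat -> box -> set (polyform -> R).

Definition moments (I : nat -> box -> set polyform) : dofs :=
  fun k f => if (k <= fdim f)%N then moment f @` I k f else set0.

(* Unisolvence on K of the moments against the spaces J f, f a face of K of
   dimension at least k: any values, linear in q, are interpolated by a unique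
   element of V. *)
Definition unisolvent (K : box) (k : nat) (V : set polyform)
    (J : box -> set polyform) : Prop :=
  forall l : box -> polyform -> R,
    (forall f, face f K -> (k <= fdim f)%N ->
       forall (a : R) (p q : polyform), J f p -> J f q ->
         l f (a *: p + q) = a * l f p + l f q) ->
    exists! u : polyform, V u /\
      forall f, face f K -> (k <= fdim f)%N ->
        forall q, J f q -> moment f q u = l f q.

(* At a vertex x of a cube, the edges at x point in all coordinate directions,
   so the endpoint derivatives of u along them are the partial derivatives of u
   at x, and the edge components of a 1-form are all its components at x.
   These degrees of freedom are attached to x, so that they are shared by all
   the cubes around x, including those that have no common edge at x. *)
Definition transfer (r : nat) (D : dofs) : dofs :=
  fun k f =>
    match fdim f, k with
    | 0, 0 => D k f `|`
        range (fun (i : 'I_n) (u : polyform) =>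
                 meval (lo f) (mderiv i (u finset.set0)))
    | 0, 1 => D k f `|`
        range (fun (i : 'I_n) (v : polyform) =>
                 meval (lo f) (v [set i]%SET))
    | 1, 0 => moment f @` poly_forms (r%:Z - 4) f 1
    | 1, 1 => moment f @` poly_forms (r%:Z - 3) f 0
    | _, _ => D k f
    end.

(* A conforming mesh of axis-parallel cubes. *)
Record mesh := Mesh {
  cells : finType;
  cell : cells -> box;
  cell_inj : injective cell;
  cell_nondegenerate : forall s i, lo (cell s) i < hi (cell s) i;
  cell_conforming : forall s t,
    (forall x, ~ (in_box (cell s) x /\ in_box (cell t) x)) \/
    (exists f, [/\ face f (cell s), face f (cell t) &
       forall x, in_box (cell s) x /\ in_box (cell t) x <-> in_box f x])
}.

Section Mesh.
Variable T : mesh.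

Definition pwform := {ffun cells T -> polyform}.

Definition pwconst (c : R) : pwform := [ffun=> const_form c].

Definition pwd (u : pwform) : pwform := [ffun s => dform (u s)].

Definition global_space (P : nat -> cells T -> set polyform) (D : dofs) (k : nat)
    : set pwform :=
  [set u | (forall s, P k s (u s)) /\
     forall (s t : cells T) (f : box), face f (cell s) -> face f (cell t) ->
       forall phi, D k f phi -> phi (u s) = phi (u t)].

(* A sequence of finite elements on every cube of the mesh: P k s is the space
   of shape functions on the cube s, and I k f the space of weights of the
   moments on the face f. *)
Record finite_elements (P : nat -> cells T -> set polyform)
    (I : nat -> box -> set polyform) : Prop := FiniteElements {
  shape_fin_dim : forall k (s : cells T), (k <= n)%N -> fin_dim (P k s);
  shape_kforms : forall k (s : cells T), (k <= n)%N -> P k s `<=` kforms k;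
  weight_fin_dim : forall k (s : cells T) f, face f (cell s) -> (k <= fdim f)%N ->
    fin_dim (I k f);
  weight_forms : forall k (s : cells T) f, face f (cell s) -> (k <= fdim f)%N ->
    I k f `<=` forms_on f (fdim f - k);
  (* point evaluations at the vertices *)
  weight_vertex : forall (s : cells T) f, face f (cell s) -> fdim f = 0%N ->
    I 0%N f = forms_on f 0;
  fe_unisolvent : forall k (s : cells T), (k <= n)%N ->
    unisolvent (cell s) k (P k s) (I k);
  fe_conforming : forall k, (k <= n)%N ->
    global_space P (moments I) k =
    [set u | (forall s, P k s (u s)) /\
       forall (s t : cells T) (f : box), face f (cell s) -> face f (cell t) ->
         ftrace f (u s) = ftrace f (u t)]
}.

Record transfer_applies (r : nat) (P : nat -> cells T -> set polyform)
    (I : nat -> box -> set polyform) : Prop := TransferApplies {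
  transfer_r_ge3 : (3 <= r)%N;
  edge_trace0 : forall (s : cells T) e, face e (cell s) -> fdim e = 1%N ->
    ftrace e @` P 0%N s = poly_forms r%:Z e 0;
  edge_weight0 : forall (s : cells T) e, face e (cell s) -> fdim e = 1%N ->
    I 0%N e = poly_forms (r%:Z - 2) e 1;
  edge_trace1 : forall (s : cells T) e, face e (cell s) -> fdim e = 1%N ->
    ftrace e @` P 1%N s = poly_forms (r%:Z - 1) e 1;
  edge_weight1 : forall (s : cells T) e, face e (cell s) -> fdim e = 1%N ->
    I 1%N e = poly_forms (r%:Z - 1) e 0
}.

(* Exactness of 0 -> R -> V 0 -> V 1 -> ... -> V n -> 0 with the differential
   applied cubewise, well-definedness of all the maps included. *)
Record exact_sequence (V : nat -> set pwform) : Prop := ExactSequence {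
  const_in : forall c, V 0%N (pwconst c);
  d_in : forall k u, (k < n)%N -> V k u -> V k.+1 (pwd u);
  exact_R : injective pwconst;
  exact_0 : forall u, V 0%N u -> (pwd u = 0 <-> exists c, pwconst c = u);
  exact_mid : forall k v, (k.+1 < n)%N -> V k.+1 v ->
    (pwd v = 0 <-> exists2 u, V k u & pwd u = v);
  exact_n : forall v, V n v -> exists2 u, V n.-1 u & pwd u = v
}.

End Mesh.
End Forms.

(* Main.v *)
(* On an edge with endpoints a and b, the traces are univariate polynomials, and
   the new degrees of freedom determine them: a trace w killed by all of them is
   B q with B = ((t - a) (b - t))^2 for 0-forms and B = (t - a) (b - t) for
   1-forms, and q is an admissible weight, so that the integral of B q^2 is 0.
   Hence T V^k is the subspace of V^k described by single-valuedness at the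
   vertices, which settles exactness at T V^0 and T V^1.  For the surjectivity
   of d from T V^1, a form v in V^1 is corrected by d phi: as the edge traces of
   v are shared, there is phi in V^0 whose trace on each edge is the cubic that
   vanishes at the endpoints and whose derivatives there are the values of v,
   and v - d phi vanishes at all vertices. *)
From HB Require Import structures.
Require Import Defs.
From mathcomp Require Import all_boot all_order all_algebra.
From mathcomp Require Import all_classical all_reals all_analysis.
From mathcomp Require Import ring zify.
From mathcomp Require polyrcf.

Set Implicit Arguments.
Unset Strict Implicit.
Unset Printing Implicit Defensive.

Import Order.TTheory GRing.Theory Num.Theory numFieldNormedType.Exports.

Local Open Scope classical_set_scope.
Local Open Scope ring_scope.

(** * Univariate polynomials on an interval: integrals and unisolvence *)

Section IntervalPolynomials.
Variable R : realType.
Implicit Types (a b c t : R) (p q B w : {poly R}).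

Definition poly_integral a b p : R :=
  \int[lebesgue_measure]_(t in `[a, b]) p.[t].

Lemma poly_integrable a b p :
  lebesgue_measure.-integrable `[a, b] (EFin \o horner p).
Proof.
apply: continuous_compact_integrable; first exact: segment_compact.
exact/continuous_subspaceT/continuous_horner.
Qed.

Lemma poly_integral_lin a b c p q :
  poly_integral a b (c *: p + q) = c * poly_integral a b p + poly_integral a b q.
Proof.
rewrite /poly_integral -RintegralZl//; last exact: poly_integrable.
rewrite -RintegralD//; try exact: poly_integrable.
  by apply: eq_Rintegral => t _; rewrite hornerD hornerZ.
rewrite [X in _.-integrable _ X](_ : _ = EFin \o horner (c *: p)).
  exact: poly_integrable.
by apply/funext => t; rewrite /= hornerZ.
Qed.

Lemma poly_integralB a b p q w :
  poly_integral a b ((p - q) * w) =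
  poly_integral a b (p * w) - poly_integral a b (q * w).
Proof.
rewrite mulrBl addrC -(scaleN1r (q * w)) poly_integral_lin.
by rewrite mulN1r addrC.
Qed.

(** At [i = 0] the coefficient is a quotient by zero, hence 0: this is the antiderivative without
    constant term. *)
Definition prim p : {poly R} := \poly_(i < (size p).+1) (p`_i.-1 / i%:R).

Lemma deriv_prim p : (prim p)^`() = p.
Proof.
apply/polyP => i; rewrite coef_deriv coef_poly ltnS.
case: ltnP => hi; last by rewrite mul0rn nth_default.
by rewrite -mulrnAr -[_ *+ _]mulr_natr mulVf ?pnatr_eq0// mulr1.
Qed.

Lemma poly_integral_prim a b p : a < b ->
  poly_integral a b p = (prim p).[b] - (prim p).[a].
Proof.
move=> ab; rewrite /poly_integral /Rintegral.
have F t : is_derive t 1 (horner (prim p)) p.[t].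
  by rewrite -{2}(deriv_prim p); exact: is_derive_poly.
rewrite (@continuous_FTC2 _ (horner p) (horner (prim p)) a b ab) //.
- exact/continuous_subspaceT/continuous_horner.
- split.
  + by move=> t _; exact: ex_derive.
  + by apply: cvg_at_right_filter; exact: continuous_horner.
  + by apply: cvg_at_left_filter; exact: continuous_horner.
- by move=> t _; rewrite derive1E; exact: derive_val.
Qed.

Lemma poly_eq0_on_itv a b p : a < b ->
  {in `[a, b], forall t, p.[t] = 0} -> p = 0.
Proof.
move=> ab p0.
(* These are [size p] distinct points of the interval, more roots than a nonzero [p] can have. *)
pose s := [seq a + (b - a) / k.+1%:R | k <- iota 0 (size p)].
apply: (@roots_geq_poly_eq0 _ p s); last by rewrite size_map size_iota.
  apply/allP => _ /mapP[k _ ->]; apply/rootP/p0.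
  rewrite in_itv/= lerDl -lerBrDl ler_pdivrMr ?ltr0Sn//.
  rewrite ler_peMr ?ler1n ?subr_ge0 ?(ltW ab)// andbT.
  by rewrite divr_ge0 ?ler0n// subr_ge0 ltW.
rewrite map_inj_uniq ?iota_uniq// => i j /addrI /mulfI.
rewrite subr_eq0 gt_eqF// => /(_ isT) /invr_inj /eqP.
by rewrite eqr_nat eqSS => /eqP.
Qed.

(** An antiderivative of [B * q * q] is nondecreasing on the interval and takes equal values at the
    two ends, so it is constant there and [B * q * q] is the zero polynomial. Since [B] is positive
    at the midpoint, it is not the zero polynomial, and [q] must be. *)
Lemma poly_integral_weight_eq0 a b B q : a < b ->
  {in `]a, b[, forall t, 0 < B.[t]} ->
  poly_integral a b (B * q * q) = 0 -> q = 0.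
Proof.
move=> ab B0; rewrite (poly_integral_prim _ ab) => /eqP.
rewrite subr_eq0 => /eqP Fab.
pose F := prim (B * q * q).
have F'0 t : t \in `]a, b[ -> 0 <= F^`().[t].
  move=> tab; rewrite deriv_prim !hornerM -mulrA -expr2.
  by rewrite mulr_ge0 ?sqr_ge0// ltW ?B0.
have Fc t : t \in `[a, b] -> (F - F.[a]%:P).[t] = 0.
  move=> tab; apply/eqP; rewrite !hornerE subr_eq0 eq_le; apply/andP; split.
    rewrite -Fab; apply: (polyrcf.ler_hornerW F'0) => //.
      by rewrite in_itv/= lexx ltW.
    by rewrite (itvP tab).
  apply: (polyrcf.ler_hornerW F'0) => //.
    by rewrite in_itv/= lexx ltW.
  by rewrite (itvP tab).
have /(congr1 deriv) := poly_eq0_on_itv ab Fc.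
rewrite derivB derivC subr0 deriv_prim deriv0 => /eqP.
rewrite -mulrA mulf_eq0 -expr2 expf_eq0/= => /orP[/eqP Bq|/eqP//].
have /B0 : (a + b) / 2 \in `]a, b[ by rewrite in_itv/= !midf_lt.
by rewrite Bq horner0 ltxx.
Qed.

Lemma factor_two a b w : a != b -> w.[a] = 0 -> w.[b] = 0 ->
  exists q, w = ('X - a%:P) * (b%:P - 'X) * q.
Proof.
move=> ab /rootP/factor_theorem[q wE]; rewrite wE hornerM hornerXsubC => /eqP.
rewrite mulf_eq0 subr_eq0 [b == a]eq_sym (negPf ab) orbF.
move=> /factor_theorem[q' ->].
(* The sign turns the factor ['X - b] into [b - 'X], which makes the product positive between [a]
   and [b]. *)
by exists (- q'); ring.
Qed.

Lemma size_factor_two a b q :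
  q != 0 -> size (('X - a%:P) * (b%:P - 'X) * q) = (size q).+2.
Proof.
move=> q0; rewrite -(opprB 'X b%:P) mulrN mulNr size_polyN -mulrA.
by rewrite !size_mul ?mulf_neq0 ?polyXsubC_eq0// !size_XsubC.
Qed.

Lemma bubble_gt0 a b t : t \in `]a, b[ ->
  0 < (('X - a%:P) * (b%:P - 'X)).[t].
Proof.
by rewrite in_itv/= => /andP[at_ tb]; rewrite !hornerE mulr_gt0 ?subr_gt0.
Qed.

Lemma lagrange_unisolvent a b (m : nat) w : a < b ->
  (size w <= m.+2)%N -> w.[a] = 0 -> w.[b] = 0 ->
  (forall q, (size q <= m)%N -> poly_integral a b (w * q) = 0) -> w = 0.
Proof.
move=> ab sw wa wb worth; have ab' : a != b by rewrite lt_eqF.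
have [q wE] := factor_two ab' wa wb.
have [q0|q0] := eqVneq q 0; first by rewrite wE q0 mulr0.
suff -> : w = 0 by [].
rewrite wE (_ : q = 0) ?mulr0//.
apply: (poly_integral_weight_eq0 ab (@bubble_gt0 a b)).
(* The quotient [q] is itself an admissible test polynomial, its size being two less than that of
   [w]. *)
by rewrite -wE; apply: worth; move: sw; rewrite wE size_factor_two.
Qed.

Lemma hermite_unisolvent a b (m : nat) w : a < b ->
  (size w <= m.+4)%N -> w.[a] = 0 -> w.[b] = 0 ->
  w^`().[a] = 0 -> w^`().[b] = 0 ->
  (forall q, (size q <= m)%N -> poly_integral a b (w * q) = 0) -> w = 0.
Proof.
move=> ab sw wa wb w'a w'b worth; have ab' : a != b by rewrite lt_eqF.
have [q wE] := factor_two ab' wa wb.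
(* At the roots [a] and [b] of the quadratic factor, the derivative of [w] reduces to [(b - a) q(a)]
   and [-(b - a) q(b)]. So [q] has both roots as well and the quadratic divides [w] twice. *)
have [qa qb] : q.[a] = 0 /\ q.[b] = 0.
  have ba : b - a != 0 by rewrite subr_eq0 eq_sym.
  move: w'a w'b; rewrite wE !poly.derivE !hornerE => qa qb.
  have {}qa : (b - a) * q.[a] = 0 by rewrite -qa; ring.
  have {}qb : (b - a) * q.[b] = 0 by rewrite -[RHS]oppr0 -qb; ring.
  by split; apply/eqP; [move/eqP: qa|move/eqP: qb]; rewrite mulf_eq0 (negPf ba).
have [q' qE] := factor_two ab' qa qb.
have [q'0|q'0] := eqVneq q' 0; first by rewrite wE qE q'0 !mulr0.
suff q'00 : q' = 0 by rewrite q'00 eqxx in q'0.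
pose B := ('X - a%:P) * (b%:P - 'X).
apply: (@poly_integral_weight_eq0 a b (B * B) q' ab).
  by move=> t tab; rewrite hornerM mulr_gt0 ?bubble_gt0.
rewrite -[B * B * q']mulrA -qE -wE; apply: worth.
move: sw; rewrite wE qE !size_factor_two//.
by rewrite -size_poly_eq0 size_factor_two.
Qed.

(** The quadratic factor has slopes [b - a] and [-(b - a)] at the ends; the linear factor takes
    there the values [da / (b - a)] and [- db / (b - a)], so that the products are the prescribed
    slopes. *)
Definition hermite_cubic a b (da db : R) : {poly R} :=
  ('X - a%:P) * (b%:P - 'X) *
  ((b - a) ^- 2 *: (da *: (b%:P - 'X) - db *: ('X - a%:P))).

Lemma size_hermite_cubic a b da db : (size (hermite_cubic a b da db) <= 4)%N.
Proof.
rewrite /hermite_cubic; set L := _ *: _.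
have [->|L0] := eqVneq L 0; first by rewrite mulr0 size_poly0.
rewrite size_factor_two// !ltnS.
apply: leq_trans (size_scale_leq _ _) _.
apply: leq_trans (size_polyD _ _) _; rewrite size_polyN geq_max.
rewrite !(leq_trans (size_scale_leq _ _))// ?size_XsubC//.
by rewrite -(opprB 'X) size_polyN size_XsubC.
Qed.

Lemma hermite_cubicP a b da db : a != b ->
  let h := hermite_cubic a b da db in
  [/\ h.[a] = 0, h.[b] = 0, h^`().[a] = da & h^`().[b] = db].
Proof.
move=> ab /=; rewrite /hermite_cubic !poly.derivE !hornerE !subrr.
have ba : b - a != 0 by rewrite subr_eq0 eq_sym.
by split; rewrite /=; field.
Qed.

End IntervalPolynomials.

(** * Restriction of multivariate polynomials to lines parallel to the axes *)

Section LineRestriction.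
Variables (R : realType) (n : nat).
Implicit Types (i j : 'I_n) (x : pt R n) (p : mpoly n R) (q : {poly R}).

(** Constants and variables generate the polynomial ring. Evaluations, traces and restrictions to
    lines are ring morphisms and are compared in this way. *)
Lemma mpoly_rmorph_ext (S : comNzRingType) (f g : {rmorphism mpoly n R -> S}) :
  (forall c, f (mpolyC n c) = g (mpolyC n c)) ->
  (forall i, f (mpolyX R (mnm1 i)) = g (mpolyX R (mnm1 i))) -> f =1 g.
Proof.
move=> fgC fgX p; rewrite (mpolyE p) !raddf_sum /=; apply: eq_bigr => m _.
rewrite -mul_mpolyC !rmorphM fgC; congr (_ * _).
rewrite mpolyXE_id !rmorph_prod; apply: eq_bigr => i _.
by rewrite !rmorphXn fgX.
Qed.

Definition line_var i x j : {poly R} := if j == i then 'X else (x j)%:P.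

(** Restriction to the line through [x] in direction [i]. The parameter is the coordinate [i] itself
    and not the distance from [x], so the ends of an edge [e] sit at the parameters [lo e i] and
    [hi e i]. *)
Definition line_poly i x : mpoly n R -> {poly R} :=
  mmap (@polyC R) (line_var i x).

HB.instance Definition _ i x := GRing.RMorphism.copy (line_poly i x)
  (mmap (@polyC R) (line_var i x)).

Lemma line_polyC i x c : line_poly i x (mpolyC n c) = c%:P.
Proof. exact: mmapC. Qed.

Lemma line_polyXU i x j : line_poly i x (mpolyX R (mnm1 j)) = line_var i x j.
Proof. by rewrite /line_poly mmapX mmap1U. Qed.

Lemma line_polyD i x : {morph line_poly i x : p q / p + q}.
Proof. exact: mmapD. Qed.

Lemma line_polyZ i x c p : line_poly i x (c *: p) = c *: line_poly i x p.
Proof. by rewrite /line_poly mmapZ mul_polyC. Qed.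

Lemma line_polyX i x m :
  line_poly i x (mpolyX R m) = (\prod_(j | j != i) x j ^+ m j) *: 'X^(m i).
Proof.
rewrite /line_poly mmapX /mmap1 (bigD1 i)//= {1}/line_var eqxx mulrC.
rewrite -mul_polyC rmorph_prod; congr (_ * _).
by apply: eq_bigr => j /negPf ji; rewrite /line_var ji rmorphXn.
Qed.

Lemma horner_line_poly i x p t :
  (line_poly i x p).[t] = meval [ffun j => if j == i then t else x j] p.
Proof.
pose f := (horner_eval t \o line_poly i x : {rmorphism _ -> _}).
apply: (mpoly_rmorph_ext (f := f)
  (g := meval [ffun j => if j == i then t else x j])) => [c|j] /=.
  by rewrite line_polyC mevalC /horner_eval hornerC.
rewrite line_polyXU mevalXU ffunE /line_var /horner_eval.
by case: eqP; rewrite ?hornerX ?hornerC.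
Qed.

Lemma deriv_line_poly i x p :
  (line_poly i x p)^`() = line_poly i x (mderiv i p).
Proof.
rewrite (mpolyE p); elim/big_rec: _ => [|m u _ IHu].
  by rewrite mderiv0 !rmorph0 deriv0.
rewrite mderivD !line_polyD derivD IHu; congr (_ + _).
rewrite mderivZ mderivX !line_polyZ !line_polyX !derivZ.
rewrite derivXn -scaler_nat !scalerA mulrAC; congr (_ * _ *: _); last first.
  by rewrite mnmBE mnm1E eqxx subn1.
apply: eq_bigr => j ji; by rewrite mnmBE mnm1E eq_sym (negPf ji) subn0.
Qed.

Lemma size_line_poly i x p : (size (line_poly i x p) <= msize p)%N.
Proof.
rewrite {1}(mpolyE p) raddf_sum; apply: leq_trans (size_sum _ _ _) _.
apply/bigmax_leqP_seq => m mp _; rewrite /= line_polyZ line_polyX.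
rewrite !(leq_trans (size_scale_leq _ _))// size_polyXn.
apply: leq_trans (msize_mdeg_lt mp); rewrite ltnS mdegE (bigD1 i)//=.
exact: leq_addr.
Qed.

(** A lift of univariate polynomials along [line_poly], by which univariate test polynomials become
    weights on an edge. *)
Definition axis_mpoly i q : mpoly n R :=
  \sum_(k < size q) q`_k *: mpolyX R (mnm1 i) ^+ k.

Lemma line_axis_mpoly i x q : line_poly i x (axis_mpoly i q) = q.
Proof.
rewrite raddf_sum -[RHS]coefK poly_def; apply: eq_bigr => k _ /=.
by rewrite line_polyZ rmorphXn /= line_polyXU /line_var eqxx.
Qed.

Lemma msize_axis_mpoly i q : (msize (axis_mpoly i q) <= size q)%N.
Proof.
apply: leq_trans (msize_sum _ _ _) _; apply/bigmax_leqP => k _.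
by rewrite (leq_trans (msizeZ_le _ _))// mpolyXn msizeX mdegMn mdeg1 mul1n.
Qed.

End LineRestriction.

(** * Moments on vertices and edges as values and univariate integrals *)

Section EdgeForms.
Variables (R : realType) (n : nat).
Implicit Types (i j : 'I_n) (e f K : box R n) (u q w : polyform R n).
Implicit Types (p : mpoly n R) (g : {poly R}).

Lemma comp_trace_meval f p : dirs f = finset.set0 ->
  meval (lo f) (comp_mpoly
    [tuple if i \in dirs f then mpolyX R (mnm1 i) else mpolyC n (lo f i) | i < n]
    p) = meval (lo f) p.
Proof.
move=> f0; rewrite comp_mpoly_meval; apply: meval_eq => i.
by rewrite tnth_mktuple f0 finset.inE mevalC.
Qed.

Lemma card_inversions0 (A B : {set 'I_n}) :
  A = finset.set0 \/ B = finset.set0 ->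
  #|[set p in finset.setX A B | (p.2 < p.1)%N]%SET| = 0%N.
Proof.
move=> AB; apply/eqP; rewrite cards_eq0; apply/eqP/finset.setP => p.
by rewrite !finset.inE; case: AB => ->; rewrite !finset.inE ?andbF.
Qed.

Lemma moment_vertex f q u : dirs f = finset.set0 ->
  moment f q u = meval (lo f) (u finset.set0) * meval (lo f) (q finset.set0).
Proof.
move=> f0; rewrite /moment /integral_form f0 enum_set0 /= ffunE.
rewrite (big_pred1 finset.set0); last by move=> A; rewrite finset.subset0.
rewrite card_inversions0; last by left.
rewrite expr0 scale1r mevalM finset.setD0 ffunE finset.sub0set.
by rewrite comp_trace_meval.
Qed.

(** The trace freezes the coordinates transversal to the edge at their values in [lo e], which the
    restriction to the line does anyway. *)
Lemma line_poly_ftrace e i w (S : {set 'I_n}) :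
  dirs e = [set i]%SET -> S \subset [set i]%SET ->
  line_poly i (lo e) (ftrace e w S) = line_poly i (lo e) (w S).
Proof.
move=> ei Si; rewrite ffunE ei Si.
set h := [tuple _ | _ < _].
pose F := (line_poly i (lo e) \o comp_mpoly h : {rmorphism _ -> _}).
apply: (mpoly_rmorph_ext (f := F) (g := line_poly i (lo e))) => [c|j] /=.
  by rewrite comp_mpolyC.
rewrite comp_mpolyXU -tnth_nth tnth_mktuple line_polyXU finset.in_set1.
rewrite /line_var; case: (j =P i) => [->|_].
  by rewrite line_polyXU /line_var eqxx.
by rewrite line_polyC.
Qed.

Lemma fwedge_edge u q i :
  fwedge u q [set i]%SET =
    u finset.set0 * q [set i]%SET + u [set i]%SET * q finset.set0.
Proof.
rewrite ffunE (bigD1 finset.set0) ?finset.sub0set//=.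
rewrite (big_pred1 [set i]%SET) => [|A]; last first.
  rewrite finset.subset1 pred1E /=; case: (eqVneq A finset.set0) => [->|].
    by rewrite orbT -cards_eq0 cards1.
  by rewrite orbF andbT eq_sym.
rewrite !card_inversions0 ?finset.setDv; [|by right|by left].
by rewrite !expr0 !scale1r finset.setD0.
Qed.

Lemma moment_edge e i q u : dirs e = [set i]%SET ->
  moment e q u = poly_integral (lo e i) (hi e i)
    (line_poly i (lo e) (u finset.set0) * line_poly i (lo e) (q [set i]%SET) +
     line_poly i (lo e) (u [set i]%SET) * line_poly i (lo e) (q finset.set0)).
Proof.
move=> ei; rewrite /moment /integral_form ei enum_set1 /=.
apply: eq_Rintegral => t _; rewrite -horner_line_poly fwedge_edge.
by rewrite line_polyD !rmorphM /= !line_poly_ftrace// finset.sub0set.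
Qed.

Lemma dform_set1 w i : dform w [set i]%SET = mderiv i (w finset.set0).
Proof.
rewrite ffunE finset.big_set1 finset.setDv.
rewrite (_ : [set _ in _ | _]%SET = finset.set0).
  by rewrite cards0 expr0 scale1r.
apply/finset.setP => j; rewrite !finset.inE.
by case: eqP => // ->; rewrite ltnn.
Qed.

(** On an edge in direction [i], the choice [S = [set i]] gives a weight for 0-forms and the empty
    [S] a weight for 1-forms. *)
Definition edge_form i (S : {set 'I_n}) g : polyform R n :=
  [ffun A : {set 'I_n} => if A == S then axis_mpoly i g else 0].

Lemma edge_form_poly_forms e i (S : {set 'I_n}) (m : int) g :
  dirs e = [set i]%SET -> S \subset [set i]%SET ->
  (size g)%:Z <= m + 1 -> poly_forms m e #|S| (edge_form i S g).
Proof.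
move=> ei Si sg; split; first split.
- by move=> A; rewrite ffunE; case: (A =P S) => // ->; rewrite eqxx.
- apply/ffunP => A; rewrite 2!ffunE ei; case: (A =P S) => [->|_]; last first.
    by rewrite comp_mpoly0; case: ifP.
  rewrite Si raddf_sum; apply: eq_bigr => k _ /=.
  rewrite comp_mpolyZ rmorphXn /= comp_mpolyXU -tnth_nth tnth_mktuple.
  by rewrite finset.set11.
- move=> A; rewrite ffunE; case: eqP => _.
    by apply: le_trans sg; rewrite lez_nat msize_axis_mpoly.
  by rewrite msize0; apply: le_trans sg.
Qed.

Lemma ftraceB f : {morph ftrace f : u w / u - w}.
Proof.
move=> u w; apply/ffunP => S; rewrite !ffunE.
by case: ifP; rewrite ?comp_mpolyB ?subr0.
Qed.

Lemma fin_dimB (V : set (polyform R n)) u w :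
  fin_dim V -> V u -> V w -> V (u - w).
Proof.
move=> [s ->] [c ->] [d ->]; exists (fun k => c k - d k).
by rewrite -sumrB; apply: eq_bigr => k _; rewrite scalerBl.
Qed.

Lemma poly_forms_sub (m m' : int) f (k : nat) :
  m <= m' -> poly_forms m f k `<=` poly_forms m' f k.
Proof.
by move=> mm w [wf ws]; split=> // S; apply: le_trans (ws S) _; rewrite lerD2r.
Qed.

End EdgeForms.

Lemma pwdB (R : realType) (n : nat) (T : mesh R n) :
  {morph @pwd R n T : u w / u - w}.
Proof.
move=> u w; apply/ffunP => s; rewrite !ffunE; apply/ffunP => S; rewrite !ffunE.
by rewrite -sumrB; apply: eq_bigr => i _; rewrite !ffunE mderivB scalerBr.
Qed.

(** * Vertices and edges of a nondegenerate cube *)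

Section Faces.
Variables (R : realType) (n : nat).
Implicit Types (i j : 'I_n) (e f K : box R n) (p : mpoly n R).

Definition nondegenerate K := forall i, lo K i < hi K i.

Lemma dirsP f i : (i \in dirs f) = (lo f i < hi f i).
Proof. by rewrite finset.inE. Qed.

Lemma face_lo_hi f K i : nondegenerate K -> face f K -> i \notin dirs f ->
  hi f i = lo f i.
Proof.
move=> K0 fK; rewrite dirsP; case: (fK i) => -[-> ->] //.
by rewrite K0.
Qed.

Definition vertex_box (x : pt R n) := Box x x.

Lemma dirs_vertex_box x : dirs (vertex_box x) = finset.set0.
Proof. by apply/finset.setP => i; rewrite dirsP ltxx finset.inE. Qed.

Lemma face_vertex_lo f K : face f K -> face (vertex_box (lo f)) K.
Proof.
move=> fK i; case: (fK i) => -[-> _] /=.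
- by apply: Or32.
- by apply: Or32.
- by apply: Or33.
Qed.

Lemma face_vertex_hi f K : face f K -> face (vertex_box (hi f)) K.
Proof.
move=> fK i; case: (fK i) => -[_ ->] /=.
- by apply: Or33.
- by apply: Or32.
- by apply: Or33.
Qed.

Lemma line_poly_lo e i p : (line_poly i (lo e) p).[lo e i] = meval (lo e) p.
Proof.
rewrite horner_line_poly; apply: meval_eq => j; rewrite ffunE.
by case: eqP => [->|].
Qed.

Lemma line_poly_hi e K i p : nondegenerate K -> face e K ->
  dirs e = [set i]%SET ->
  (line_poly i (lo e) p).[hi e i] = meval (hi e) p.
Proof.
move=> K0 eK ei; rewrite horner_line_poly; apply: meval_eq => j; rewrite ffunE.
case: eqP => [->//|/eqP ji]; rewrite (face_lo_hi K0 eK)//.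
by rewrite ei finset.in_set1.
Qed.

Lemma edge_at_vertex f K i : nondegenerate K -> face f K ->
  dirs f = finset.set0 ->
  exists e, [/\ face e K, dirs e = [set i]%SET & lo f = lo e \/ lo f = hi e].
Proof.
move=> K0 fK f0.
(* The edge through the vertex [f] in direction [i]: the full side of [K] in that direction, frozen
   coordinates elsewhere. *)
pose e := Box [ffun j => if j == i then lo K j else lo f j]
              [ffun j => if j == i then hi K j else lo f j].
exists e; split.
- move=> j; rewrite !ffunE; case: eqP => _; first exact: Or31.
  by case: (fK j) => -[-> _]; [apply: Or32|apply: Or32|apply: Or33].
- apply/finset.setP => j; rewrite dirsP !ffunE finset.in_set1.
  by case: eqP => [->|_]; rewrite ?K0 ?ltxx.
- have [fi|fi] : lo f i = lo K i \/ lo f i = hi K i.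
    by case: (fK i) => -[-> _]; [left|left|right].
  + by left; apply/ffunP => j; rewrite ffunE; case: eqP => [->|].
  + by right; apply/ffunP => j; rewrite ffunE; case: eqP => [->|].
Qed.

Lemma fdim0 f : fdim f = 0%N -> dirs f = finset.set0.
Proof. by move/eqP; rewrite cards_eq0 => /eqP. Qed.

Lemma fdim1 f : fdim f = 1%N -> exists i, dirs f = [set i]%SET.
Proof. by move/eqP/cards1P => [i ->]; exists i. Qed.

End Faces.

(** * Shape functions on edges and at vertices *)

Section Transfer.
Variables (R : realType) (n : nat) (T : mesh R n) (r : nat).
Variables (P : nat -> cells T -> set (polyform R n)).
Variable I : nat -> box R n -> set (polyform R n).
Hypotheses (hFE : finite_elements P I) (hT : transfer_applies r P I).

Local Notation V := (global_space P (moments I)).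
Local Notation TV := (global_space P (transfer r (moments I))).
Implicit Types (s t : cells T) (e f : box R n) (i : 'I_n) (u v : pwform T).

Lemma cell_is_nondegenerate s : nondegenerate (cell s). Proof. exact: cell_nondegenerate. Qed.

Lemma shape_vanish k s (w : polyform R n) (S : {set 'I_n}) :
  (k <= n)%N -> P k s w -> #|S| != k -> w S = 0.
Proof. by move=> kn /(shape_kforms hFE kn); apply. Qed.

Lemma size_edge0 s e i w : face e (cell s) -> dirs e = [set i]%SET ->
  P 0%N s w -> (size (line_poly i (lo e) (w finset.set0)) <= r.+1)%N.
Proof.
move=> es ei Pw; have de : fdim e = 1%N by rewrite /fdim ei cards1.
have : (ftrace e @` P 0%N s) (ftrace e w) by exists w.
rewrite (edge_trace0 hT es de) => -[_ /(_ finset.set0)].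
rewrite -(line_poly_ftrace w ei) ?finset.sub0set// => sz.
by apply: leq_trans (size_line_poly _ _ _) _; lia.
Qed.

Lemma size_edge1 s e i w : face e (cell s) -> dirs e = [set i]%SET ->
  P 1%N s w -> (size (line_poly i (lo e) (w [set i]%SET)) <= r)%N.
Proof.
move=> es ei Pw; have de : fdim e = 1%N by rewrite /fdim ei cards1.
have : (ftrace e @` P 1%N s) (ftrace e w) by exists w.
rewrite (edge_trace1 hT es de) => -[_ /(_ [set i]%SET)].
rewrite -(line_poly_ftrace w ei)// => sz.
by apply: leq_trans (size_line_poly _ _ _) _; lia.
Qed.

Hypothesis n_gt1 : (1 < n)%N.

Let n_gt0 : (0 < n)%N. Proof. exact: ltnW. Qed.

Lemma moment_edge0 s e i w q : dirs e = [set i]%SET -> P 0%N s w ->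
  moment e q w = poly_integral (lo e i) (hi e i)
    (line_poly i (lo e) (w finset.set0) * line_poly i (lo e) (q [set i]%SET)).
Proof.
move=> ei Pw; rewrite (moment_edge _ _ ei).
rewrite (shape_vanish (S := [set i]%SET) _ Pw) ?cards1//.
by rewrite rmorph0 mul0r addr0.
Qed.

Lemma moment_edge1 s e i w q : dirs e = [set i]%SET -> P 1%N s w ->
  moment e q w = poly_integral (lo e i) (hi e i)
    (line_poly i (lo e) (w [set i]%SET) * line_poly i (lo e) (q finset.set0)).
Proof.
move=> ei Pw; rewrite (moment_edge _ _ ei).
rewrite (shape_vanish (S := finset.set0) _ Pw) ?cards0//.
by rewrite rmorph0 mul0r add0r.
Qed.

(** The constant weight 1 turns the vertex moment into point evaluation. *)
Lemma vertex_value_dof s f : face f (cell s) -> dirs f = finset.set0 ->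
  moments I 0 f (moment f (const_form n 1)) /\
  forall w, moment f (const_form n 1) w = meval (lo f) (w finset.set0).
Proof.
move=> fs f0; have df : fdim f = 0%N by rewrite /fdim f0 cards0.
split; last first.
  by move=> w; rewrite moment_vertex// ffunE eqxx mevalC mulr1.
exists (const_form n 1) => //; rewrite (weight_vertex hFE fs df); split.
  move=> S; rewrite ffunE; case: (S =P finset.set0) => // ->.
  by rewrite cards0.
apply/ffunP => S; rewrite 2!ffunE f0; case: (S =P finset.set0) => [->|_].
  by rewrite finset.sub0set comp_mpolyC.
by rewrite comp_mpoly0 if_same.
Qed.

(** * The transferred global spaces as subspaces of the original ones *)

Lemma vertex_dof_deriv f i : fdim f = 0%N ->
  transfer r (moments I) 0 f
    (fun w => meval (lo f) (mderiv i (w finset.set0))).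
Proof. by rewrite /transfer => ->; right; exists i. Qed.

Lemma vertex_dof_component f i : fdim f = 0%N ->
  transfer r (moments I) 1 f (fun w => meval (lo f) (w [set i]%SET)).
Proof. by rewrite /transfer => ->; right; exists i. Qed.

Lemma vertex_dof_value f phi : fdim f = 0%N ->
  moments I 0 f phi -> transfer r (moments I) 0 f phi.
Proof. by rewrite /transfer => ->; left. Qed.

(** Only the edge moments have to be recovered. The difference of the traces from two cells has
    degree at most [r]; it has zero values and slopes at both ends and zero moments of degree up to
    [r - 4], which are [r + 1] conditions forcing it to vanish. *)
Lemma transfer_sub0 : TV 0%N `<=` V 0%N.
Proof.
move=> u [Pu uT]; split=> // s t f fs ft phi.
have [df|df|df] : [\/ fdim f = 0, fdim f = 1 | 1 < fdim f]%N.
- by case: (fdim f) => [|[|k]]; [apply: Or31|apply: Or32|apply: Or33].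
- by move=> Dphi; apply: (uT s t f) => //; exact: vertex_dof_value.
- have [i fi] := fdim1 df.
  have ab : lo f i < hi f i by rewrite -dirsP fi finset.set11.
  rewrite /moments df /= => -[q Iq <-].
  rewrite !(moment_edge0 _ fi (Pu _)).
  suff -> : line_poly i (lo f) (u s finset.set0) =
            line_poly i (lo f) (u t finset.set0) by [].
  have value x (xs : face (vertex_box x) (cell s))
      (xt : face (vertex_box x) (cell t)) :
      meval x (u s finset.set0) = meval x (u t finset.set0) /\
      meval x (mderiv i (u s finset.set0)) =
      meval x (mderiv i (u t finset.set0)).
    have x0 := dirs_vertex_box x.
    have dx : fdim (vertex_box x) = 0%N by rewrite /fdim x0 cards0.
    split; last exact: (uT s t _ xs xt _ (vertex_dof_deriv i dx)).
    have [Dx mx] := vertex_value_dof xs x0.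
    by move: (uT s t _ xs xt _ (vertex_dof_value dx Dx)); rewrite !mx.
  have [vlo dlo] := value _ (face_vertex_lo fs) (face_vertex_lo ft).
  have [vhi dhi] := value _ (face_vertex_hi fs) (face_vertex_hi ft).
  have hs := line_poly_hi _ (@cell_is_nondegenerate s) fs fi.
  have r3 := transfer_r_ge3 hT.
  apply/eqP; rewrite -subr_eq0; apply/eqP.
  (* Size at most [r - 3] is degree at most [r - 4]. For [r = 3] only the zero test polynomial is
     left, and the four endpoint conditions determine the cubic. *)
  apply: (hermite_unisolvent (m := r - 3) ab).
  + apply: leq_trans (size_polyD _ _) _; rewrite size_polyN geq_max.
    rewrite (_ : (r - 3).+4 = r.+1); last lia.
    apply/andP; split; [exact: size_edge0 fi (Pu s)|exact: size_edge0 fi (Pu t)].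
  + by rewrite hornerD hornerN !line_poly_lo vlo subrr.
  + by rewrite hornerD hornerN !hs vhi subrr.
  + by rewrite derivB !deriv_line_poly hornerD hornerN !line_poly_lo dlo subrr.
  + by rewrite derivB !deriv_line_poly hornerD hornerN !hs dhi subrr.
  move=> g sg; rewrite poly_integralB.
  have F : poly_forms (r%:Z - 4) f 1 (edge_form i [set i]%SET g).
    rewrite -[X in poly_forms _ _ X](cards1 i).
    by apply: edge_form_poly_forms => //; lia.
  have := uT s t f fs ft (moment f (edge_form i [set i]%SET g)).
  rewrite /transfer df => /(_ (ex_intro2 _ _ _ F erefl)).
  rewrite !(moment_edge0 _ fi (Pu _)) !ffunE eqxx line_axis_mpoly => ->.
  by rewrite subrr.
- move=> Dphi; apply: (uT s t f) => //; rewrite /transfer.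
  by case: (fdim f) df Dphi => [|[|k]].
Qed.

(** As for 0-forms, with traces of degree at most [r - 1]: two endpoint values and the moments of
    degree up to [r - 3] make up the [r] conditions. *)
Lemma transfer_sub1 : TV 1%N `<=` V 1%N.
Proof.
move=> u [Pu uT]; split=> // s t f fs ft phi.
have [df|df|df] : [\/ fdim f = 0, fdim f = 1 | 1 < fdim f]%N.
- by case: (fdim f) => [|[|k]]; [apply: Or31|apply: Or32|apply: Or33].
- by rewrite /moments df.
- have [i fi] := fdim1 df.
  have ab : lo f i < hi f i by rewrite -dirsP fi finset.set11.
  rewrite /moments df /= => -[q Iq <-].
  rewrite !(moment_edge1 _ fi (Pu _)).
  suff -> : line_poly i (lo f) (u s [set i]%SET) =
            line_poly i (lo f) (u t [set i]%SET) by [].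
  have value x (xs : face (vertex_box x) (cell s))
      (xt : face (vertex_box x) (cell t)) :
      meval x (u s [set i]%SET) = meval x (u t [set i]%SET).
    have dx : fdim (vertex_box x) = 0%N by rewrite /fdim dirs_vertex_box cards0.
    exact: (uT s t _ xs xt _ (vertex_dof_component i dx)).
  have vlo := value _ (face_vertex_lo fs) (face_vertex_lo ft).
  have vhi := value _ (face_vertex_hi fs) (face_vertex_hi ft).
  have hs := line_poly_hi _ (@cell_is_nondegenerate s) fs fi.
  have r3 := transfer_r_ge3 hT.
  apply/eqP; rewrite -subr_eq0; apply/eqP.
  apply: (lagrange_unisolvent (m := r - 2) ab).
  + apply: leq_trans (size_polyD _ _) _; rewrite size_polyN geq_max.
    rewrite (_ : (r - 2).+2 = r); last lia.
    apply/andP; split; [exact: size_edge1 fi (Pu s)|exact: size_edge1 fi (Pu t)].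
  + by rewrite hornerD hornerN !line_poly_lo vlo subrr.
  + by rewrite hornerD hornerN !hs vhi subrr.
  move=> g sg; rewrite poly_integralB.
  have F : poly_forms (r%:Z - 3) f 0 (edge_form i finset.set0 g).
    rewrite -[X in poly_forms _ _ X](@cards0 'I_n).
    apply: edge_form_poly_forms => //; last lia.
    exact: finset.sub0set.
  have := uT s t f fs ft (moment f (edge_form i finset.set0 g)).
  rewrite /transfer df => /(_ (ex_intro2 _ _ _ F erefl)).
  rewrite !(moment_edge1 _ fi (Pu _)) !ffunE eqxx line_axis_mpoly => ->.
  by rewrite subrr.
- move=> Dphi; apply: (uT s t f) => //; rewrite /transfer.
  by case: (fdim f) df Dphi => [|[|k]].
Qed.

Lemma transfer_ge2 k : (1 < k)%N -> TV k = V k.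
Proof.
case: k => [|[|k]]// _; rewrite /global_space.
suff -> : transfer r (moments I) k.+2 = moments I k.+2 by [].
by apply/funext => f; rewrite /transfer; case: (fdim f) => [|[|]].
Qed.

(** The edge moments that survive are against a subspace of the old weights, so only the new vertex
    conditions have to be supplied. *)
Lemma mem_transfer0 u : V 0%N u ->
  (forall s t f i, face f (cell s) -> face f (cell t) -> dirs f = finset.set0 ->
     meval (lo f) (mderiv i (u s finset.set0)) =
     meval (lo f) (mderiv i (u t finset.set0))) ->
  TV 0%N u.
Proof.
move=> [Pu uD] uV; split=> // s t f fs ft phi; rewrite /transfer.
case df : (fdim f) => [|[|k]]; last exact: uD.
  by case=> [|[i _ <-]]; [exact: uD|apply: uV => //; exact: fdim0].
move=> [q qf <-]; apply: (uD s t f fs ft); exists q => //.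
rewrite (edge_weight0 hT fs df).
by apply: poly_forms_sub qf; rewrite lerD2l lerN2.
Qed.

Lemma mem_transfer1 u : V 1%N u ->
  (forall s t f i, face f (cell s) -> face f (cell t) -> dirs f = finset.set0 ->
     meval (lo f) (u s [set i]%SET) = meval (lo f) (u t [set i]%SET)) ->
  TV 1%N u.
Proof.
move=> [Pu uD] uV; split=> // s t f fs ft phi; rewrite /transfer.
case df : (fdim f) => [|[|k]]; last exact: uD.
  by case=> [|[i _ <-]]; [exact: uD|apply: uV => //; exact: fdim0].
move=> [q qf <-]; apply: (uD s t f fs ft); rewrite /moments df /=; exists q => //.
rewrite (edge_weight1 hT fs df).
by apply: poly_forms_sub qf; rewrite lerD2l lerN2.
Qed.

(** * Correction of a 1-form by an exact form so that it vanishes at the vertices *)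

Definition edge_hermite e i (w : polyform R n) : {poly R} :=
  hermite_cubic (lo e i) (hi e i)
    (meval (lo e) (w [set i]%SET)) (meval (hi e) (w [set i]%SET)).

(** Data for the interpolation of a 0-form. On an edge the sum has one term, which picks its
    direction without a choice; on faces of any other dimension it is empty, so that zero is
    prescribed there, in particular at the vertices. *)
Definition edge_data (w : polyform R n) f (q : polyform R n) : R :=
  \sum_(i in dirs f | fdim f == 1%N) poly_integral (lo f i) (hi f i)
    (edge_hermite f i w * line_poly i (lo f) (q [set i]%SET)).

Lemma edge_data_lin w f a p q :
  edge_data w f (a *: p + q) = a * edge_data w f p + edge_data w f q.
Proof.
rewrite /edge_data mulr_sumr -big_split; apply: eq_bigr => i _ /=.
rewrite -poly_integral_lin; congr poly_integral.
by rewrite !ffunE line_polyD line_polyZ mulrDr scalerAr.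
Qed.

Lemma edge_data_edge w e i q : dirs e = [set i]%SET ->
  edge_data w e q = poly_integral (lo e i) (hi e i)
    (edge_hermite e i w * line_poly i (lo e) (q [set i]%SET)).
Proof.
move=> ei; rewrite /edge_data (big_pred1 i)// => j.
by rewrite /fdim ei cards1 eqxx andbT finset.in_set1.
Qed.

Lemma edge_data_vertex w f q : dirs f = finset.set0 -> edge_data w f q = 0.
Proof.
move=> f0; rewrite /edge_data f0 big_pred0// => i.
by rewrite finset.in_set0.
Qed.

(** Conformity makes the whole edge trace of [v] common to both cells, hence also its endpoint
    values, from which the cubic is built. *)
Lemma edge_data_shared v s t f q : V 1%N v ->
  face f (cell s) -> face f (cell t) ->
  edge_data (v s) f q = edge_data (v t) f q.
Proof.
rewrite (fe_conforming hFE n_gt0) => -[_ vtr] fs ft.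
apply: eq_bigr => i /andP[fi /eqP/fdim1[j fj]].
have {j fj fi} fi : dirs f = [set i]%SET.
  by move: fi; rewrite fj finset.in_set1 => /eqP ->.
suff lst : line_poly i (lo f) (v s [set i]%SET) =
           line_poly i (lo f) (v t [set i]%SET).
  have vlo : meval (lo f) (v s [set i]%SET) = meval (lo f) (v t [set i]%SET).
    by rewrite -(line_poly_lo f i) lst line_poly_lo.
  have vhi : meval (hi f) (v s [set i]%SET) = meval (hi f) (v t [set i]%SET).
    have hs := line_poly_hi _ (@cell_is_nondegenerate s) fs fi.
    by rewrite -hs lst hs.
  by rewrite /edge_hermite vlo vhi.
by rewrite -(line_poly_ftrace _ fi)// (vtr s t)// line_poly_ftrace.
Qed.

(** On an edge at the vertex, [phi] and the Hermite cubic agree at the ends and in all moments of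
    degree up to [r - 2]. Both have degree at most [r], so they coincide, and the slopes of the
    cubic are the components of [w]. *)
Lemma edge_hermite_interpolation s w phi : P 1%N s w -> P 0%N s phi ->
  (forall f, face f (cell s) ->
     forall q, I 0%N f q -> moment f q phi = edge_data w f q) ->
  forall f i, face f (cell s) -> dirs f = finset.set0 ->
    meval (lo f) (mderiv i (phi finset.set0)) = meval (lo f) (w [set i]%SET).
Proof.
move=> Pw Pphi phiD f i fs f0.
have [e [es ei fe]] := edge_at_vertex i (@cell_is_nondegenerate s) fs f0.
have ab : lo e i < hi e i by rewrite -dirsP ei finset.set11.
have hs := line_poly_hi _ (@cell_is_nondegenerate s) es ei.
have de : fdim e = 1%N by rewrite /fdim ei cards1.
have r3 := transfer_r_ge3 hT.
have [ha hb h'a h'b] := hermite_cubicP (meval (lo e) (w [set i]%SET))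
  (meval (hi e) (w [set i]%SET)) (negbT (lt_eqF ab)).
have value0 x : face (vertex_box x) (cell s) -> meval x (phi finset.set0) = 0.
  move=> xs; have x0 := dirs_vertex_box x.
  have [[q Iq qE] mx] := vertex_value_dof xs x0.
  by rewrite -(mx phi) -qE (phiD _ xs _ Iq) edge_data_vertex.
have phiH : line_poly i (lo e) (phi finset.set0) = edge_hermite e i w.
  apply/eqP; rewrite -subr_eq0; apply/eqP.
  apply: (lagrange_unisolvent (m := r.-1) ab).
  + apply: leq_trans (size_polyD _ _) _; rewrite size_polyN geq_max.
    rewrite (_ : r.-1.+2 = r.+1); last lia.
    rewrite (size_edge0 es ei Pphi) /=.
    (* The cubic is an admissible trace because [r] is at least 3. *)
    by apply: leq_trans (size_hermite_cubic _ _ _ _) _.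
  + by rewrite hornerD hornerN line_poly_lo ha value0 ?subrr//;
      exact: face_vertex_lo.
  + by rewrite hornerD hornerN hs hb value0 ?subrr//;
      exact: face_vertex_hi.
  move=> g sg; rewrite poly_integralB.
  have F : I 0%N e (edge_form i [set i]%SET g).
    rewrite (edge_weight0 hT es de) -[X in poly_forms _ _ X](cards1 i).
    by apply: edge_form_poly_forms => //; lia.
  have := phiD e es _ F.
  rewrite (moment_edge0 _ ei Pphi) (edge_data_edge _ _ ei).
  by rewrite ffunE eqxx line_axis_mpoly => ->; rewrite subrr.
case: fe => ->.
  by rewrite -(line_poly_lo e i) -deriv_line_poly phiH h'a.
by rewrite -hs -deriv_line_poly phiH h'b.
Qed.

Hypothesis hV : exact_sequence V.

(** Unisolvence gives [phi] cell by cell, and the shared edge data make it single-valued. In each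
    cell the gradient of [phi] equals [v] at every vertex, so the difference is zero there, whatever
    the cell. *)
Lemma correction v : V 1%N v -> exists2 phi, V 0%N phi & TV 1%N (v - pwd phi).
Proof.
move=> Vv; have [Pv _] := Vv.
have /choice[phi phiP] : forall s, exists w, P 0%N s w /\
    forall f, face f (cell s) -> forall q, I 0%N f q ->
      moment f q w = edge_data (v s) f q.
  move=> s; have [|w [[Pw wD] _]] :=
    @fe_unisolvent _ _ _ _ _ hFE 0%N s (leq0n n) (edge_data (v s)).
    by move=> f _ _ a p q _ _; exact: edge_data_lin.
  by exists w; split=> // f fs q Iq; exact: wD.
pose u : pwform T := [ffun s => phi s].
have Vu : V 0%N u.
  split=> [s|s t f fs ft _ [q Iq <-]]; first by rewrite ffunE; case: (phiP s).
  rewrite !ffunE (phiP s).2// (phiP t).2//.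
  exact: edge_data_shared.
have [_ dVu _ _ _ _] := hV.
have subE s : (v - pwd u) s = v s - pwd u s by rewrite !ffunE.
exists u => //; apply: mem_transfer1 => //.
  have := dVu 0%N u n_gt0 Vu; have := Vv.
  (* Membership of the difference is checked on traces, which are additive. *)
  rewrite (fe_conforming hFE n_gt0) => -[_ vtr] [Pdu dutr].
  split=> [s|s t f fs ft].
    rewrite subE; exact: fin_dimB (shape_fin_dim hFE _ n_gt0) (Pv s) (Pdu s).
  by rewrite !subE !ftraceB (vtr s t)// (dutr s t).
have zero s f i : face f (cell s) -> dirs f = finset.set0 ->
    meval (lo f) ((v - pwd u) s [set i]%SET) = 0.
  move=> fs f0; have [Pphi phiE] := phiP s.
  have -> : (v - pwd u) s [set i]%SET =
      v s [set i]%SET - dform (phi s) [set i]%SET.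
    by rewrite !ffunE.
  rewrite mevalB dform_set1.
  rewrite (edge_hermite_interpolation (Pv s) Pphi phiE i fs f0).
  exact: subrr.
by move=> s t f i fs ft f0; rewrite !zero.
Qed.

End Transfer.

(** * Exactness of the transferred sequence, position by position *)

Lemma transfer_exact (R : realType) (n : nat) (n_gt1 : (1 < n)%N)
  (T : mesh R n) (r : nat)
  (P : nat -> cells T -> set (polyform R n))
  (I : nat -> box R n -> set (polyform R n))
  (hFE : finite_elements P I) (hT : transfer_applies r P I)
  (hV : exact_sequence (global_space P (moments I))) :
  exact_sequence (global_space P (transfer r (moments I))).
Proof.
set V := global_space P (moments I) in hV.
have sub0 := transfer_sub0 hFE hT n_gt1.
have sub1 := transfer_sub1 hFE hT n_gt1.
have ge2 := @transfer_ge2 R n T r P I.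
have [Vc Vd VR V0 Vk Vn] := hV.
(* That [d] squares to zero is read off from the exactness of the original sequence at [V 1]. *)
have dd u : V 0%N u -> pwd (pwd u) = 0.
  move=> Vu; have Vdu := Vd 0%N u (ltnW n_gt1) Vu.
  by apply/(Vk 0%N _ n_gt1 Vdu); exists u.
(* The correction changes a preimage in [V 1] by an exact form only, so its differential stays the
   same. *)
have lift v w : V 1%N w -> pwd w = v ->
    exists2 u, global_space P (transfer r (moments I)) 1%N u & pwd u = v.
  move=> Vw wv; have [phi Vphi Tw] := correction hFE hT n_gt1 hV Vw.
  by exists (w - pwd phi) => //; rewrite pwdB dd// subr0.
split.
- move=> c; apply: mem_transfer0 => //; first exact: Vc.
  move=> s t f i _ _ _.
  by rewrite !ffunE eqxx mderivC.
- case=> [|[|k]] u kn uT.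
  + apply: mem_transfer1 => //; first exact: Vd (sub0 _ uT).
    move=> s t f i fs ft f0.
    (* The new vertex conditions for [pwd u] are those for [u], since the components of the
       differential are the partial derivatives. *)
    have duE c : pwd u c [set i]%SET = mderiv i (u c finset.set0).
      by rewrite -dform_set1 [pwd u c]ffunE.
    rewrite !duE; have [_ uD] := uT.
    apply: (uD s t f fs ft _ (vertex_dof_deriv _ _ i _)).
    by rewrite /fdim f0 cards0.
  + by rewrite ge2//; apply: Vd => //; exact: sub1.
  + by move: uT; rewrite !ge2//; exact: Vd.
- exact: VR.
- by move=> u /sub0; exact: V0.
- case=> [|[|k]] v kn vT.
  + split=> [dv0|[u /sub0 Vu uv]]; last first.
      by apply/(Vk 0%N v kn (sub1 _ vT)); exists u.
    have /(Vk 0%N v kn (sub1 _ vT))[u Vu uv] := dv0.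
    (* Any potential will do: its partial derivatives are the components of [v], which are
       single-valued at the vertices. *)
    exists u => //; apply: mem_transfer0 => // s t f i fs ft f0.
    rewrite -!dform_set1; have [_ vD] := vT.
    have du c : dform (u c) = v c by rewrite -uv ffunE.
    rewrite !du; apply: (vD s t f fs ft _ (vertex_dof_component _ _ i _)).
    by rewrite /fdim f0 cards0.
  + move: vT; rewrite ge2// => Vv; split.
      by move=> /(Vk 1%N v kn Vv)[w Vw wv]; exact: lift Vw wv.
    by move=> [u /sub1 Vu uv]; apply/(Vk 1%N v kn Vv); exists u.
  + by move: vT; rewrite !ge2//; exact: Vk.
- move=> v; rewrite ge2// => /Vn[w Vw wv].
  (* For [n = 2] the last map starts from [V 1] and the preimage must be corrected; otherwise it
     starts from a space that the transfer leaves unchanged. *)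
  have [n1|n1] := eqVneq n.-1 1%N.
    by move: Vw; rewrite n1 => Vw; exact: lift Vw wv.
  by exists w => //; rewrite ge2//; lia.
Qed.

Local Close Scope ring_scope.
Local Close Scope classical_set_scope.

Theorem lemma3 (R : realType) (n : nat) (hn : n = 2 \/ n = 3)
  (T : mesh R n) (r : nat)
  (P : nat -> cells T -> set (polyform R n))
  (I : nat -> box R n -> set (polyform R n))
  (hFE : finite_elements P I) (hT : transfer_applies r P I)
  (hV : exact_sequence (global_space P (moments I))) :
  exact_sequence (global_space P (transfer r (moments I))).
Proof. by apply: transfer_exact => //; case: hn => ->. Qed.
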